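(* Let $m,n\ge 1$ be integers, $\Omega=\{1,\dots,m\}$, $\mathcal{X}\subseteq\mathbb{R}^n$ a nonempty set, $J:\mathbb{R}^n\times\Omega\to\mathbb{R}$ a function (the cost function), $d>0$ a constant, and $p_0\in\mathcal{P}(\Omega)$ with $p_0(i)>0$ for every $i\in\Omega$. Let $\mathcal{W}$ be the ambiguity set and $\tilde h$ the function defined in the context. Consider the two problems $$\text{(A)}\quad \min_{\boldsymbol{x}\in\mathcal{X}}\ \max_{\hat p\in\mathcal{W}}\ \sum_{i\in\Omega}\hat p(i)\,J(\boldsymbol{x},i),$$ $$\text{(B)}\quad \min_{\boldsymbol{x}\in\mathcal{X}}\ \inf_{(\boldsymbol{\lambda},s)\in[0,\infty)^m\times\mathbb{R}}\ \sum_{i\in\Omega}p_0(i)\,\tilde h(\boldsymbol{x},i,[\boldsymbol{\lambda}]_i,s).$$ Then: 1. The optimal minimizers $\boldsymbol{x}$ of (B) are the same as the optimal minimizers $\boldsymbol{x}$ of (A). That is, $\boldsymbol{x}^*\in\mathcal{X}$ minimizes $\boldsymbol{x}\mapsto\inf_{(\boldsymbol{\lambda},s)\in[0,\infty)^m\times\mathbb{R}}\sum_{i}p_0(i)\tilde h(\boldsymbol{x},i,[\boldsymbol{\lambda}]_i,s)$ over $\mathcal{X}$ if and only if it minimizes $\boldsymbol{x}\mapsto\max_{\hat p\in\mathcal{W}}\sum_i\hat p(i)J(\boldsymbol{x},i)$ over $\mathcal{X}$. 2. If $\mathcal{X}$ is a bounded closed convex set and, for each $i\in\Omega$, $J(\cdot,i)$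 is strictly convex and continuous on $\mathcal{X}$, then the optimal minimizer $\boldsymbol{x}$ of (B) is unique (there is exactly one). 3. If $\mathcal{X}$ is an open convex set and, for each $i\in\Omega$, $J(\cdot,i)$ is convex and of class $C^k$ on $\mathcal{X}$, then the objective function of (B), $(\boldsymbol{x},\boldsymbol{\lambda},s)\mapsto\sum_{i\in\Omega}p_0(i)\,\tilde h(\boldsymbol{x},i,[\boldsymbol{\lambda}]_i,s)$, is convex and of class $C^k$ on $\mathcal{X}\times(0,\infty)^m\times\mathbb{R}$.
   Context: $\mathcal{P}(\Omega)=\{p:\Omega\to[0,\infty)\mid\sum_{i\in\Omega}p(i)=1\}$ is the set of probability mass functions on $\Omega$. $[\boldsymbol{v}]_i$ denotes the $i$-th component of a vector $\boldsymbol{v}$. Ambiguity set: $\mathcal{W}=\{\hat p\in\mathcal{P}(\Omega)\mid \forall i\in\Omega,\ \hat p(i)/p_0(i)\le 1+d\}$. The function $\tilde h$ takes values in $\mathbb{R}\cup\{\infty\}$ and is defined, for $\boldsymbol{x}\in\mathcal{X}$, $i\in\Omega$, $\lambda\in\mathbb{R}$, $s\in\mathbb{R}$, by $$\tilde h(\boldsymbol{x},i,\lambda,s)=\begin{cases} s, & \lambda=0,\ J(\boldsymbol{x},i)\le s,\\[2pt] (1+d)\,\lambda\exp\!\left(\dfrac{J(\boldsymbol{x},i)-\lambda-s}{\lambda}\right)+s, & \lambda\ne 0,\\[6pt] \infty, & \lambda=0,\ J(\boldsymbol{x},i)>s.\end{cases}$$ *)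

(* Defs.v *)
From HB Require Import structures.
From mathcomp Require Import all_boot all_order all_algebra.
From mathcomp Require Import all_classical all_reals all_analysis.

Set Implicit Arguments.
Unset Strict Implicit.
Unset Printing Implicit Defensive.

Import Order.TTheory GRing.Theory Num.Theory.
Import numFieldNormedType.Exports.

Local Open Scope classical_set_scope.
Local Open Scope ring_scope.

Section problems.
Context {R : realType} {n m : nat}.
Implicit Types (X : set 'rV[R]_n) (J : 'rV[R]_n -> 'I_m -> R) (d : R).
Implicit Types (p q : 'I_m -> R) (x : 'rV[R]_n).

Definition is_pmf : set ('I_m -> R) :=
  [set p | (forall i, 0 <= p i) /\ \sum_i p i = 1].

Definition ambiguity_set d p0 : set ('I_m -> R) :=
  [set p | is_pmf p /\ forall i, p i / p0 i <= 1 + d].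

Definition expected_cost J p x : R := \sum_i p i * J x i.

(* The maximum over the ambiguity set is written as a supremum; by
   [worst_case_cost_max] below it is attained. *)
Definition worst_case_cost J d p0 x : R :=
  sup [set expected_cost J p x | p in ambiguity_set d p0].

Definition htilde J d x (i : 'I_m) (lambda s : R) : \bar R :=
  if lambda == 0 then
    if J x i <= s then s%:E else +oo%E
  else
    ((1 + d) * lambda * expR ((J x i - lambda - s) / lambda) + s)%:E.

Definition dual_objective J d p0 (z : 'rV[R]_n * 'rV[R]_m * R) : \bar R :=
  (\sum_i (p0 i)%:E * htilde J d z.1.1 i (z.1.2 ord0 i) z.2)%E.

Definition dual_cost J d p0 x : \bar R :=
  ereal_inf [set dual_objective J d p0 (x, ls.1, ls.2) |
              ls in [set ls : 'rV[R]_m * R | forall i, 0 <= ls.1 ord0 i]].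

Definition worst_case_minimizer X J d p0 x : Prop :=
  X x /\ forall y, X y -> worst_case_cost J d p0 x <= worst_case_cost J d p0 y.

Definition dual_minimizer X J d p0 x : Prop :=
  X x /\ forall y, X y -> (dual_cost J d p0 x <= dual_cost J d p0 y)%E.

End problems.

Definition strictly_convex_function (R : realType) (E : lmodType R)
    (D : set E) (f : E -> R) : Prop :=
  forall (t : R) (x y : E), 0 < t < 1 -> D x -> D y -> x != y ->
    f (t *: x + (1 - t) *: y) < t * f x + (1 - t) * f y.

(* Class C^k on an open subset of a finite-dimensional space, where f is C^(k+1)
   iff it is differentiable and its differential, read off vector by vector
   ('D_v f a = 'd f a v), is C^k. *)
Fixpoint Ck (R : realType) (V : normedModType R) (k : nat) (U : set V)
    (f : V -> R) : Prop :=
  if k is k'.+1 then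
    (forall x, U x -> differentiable f x) /\ forall v, Ck k' U ('D_v f)
  else forall x, U x -> {for x, continuous f}.

Lemma worst_case_cost_max (R : realType) (n m : nat)
    (J : 'rV[R]_n -> 'I_m -> R) (d : R) (p0 : 'I_m -> R) (x : 'rV[R]_n) :
  0 < d -> is_pmf p0 -> (forall i, 0 < p0 i) ->
  exists p, [/\ ambiguity_set d p0 p, expected_cost J p x = worst_case_cost J d p0 x
    & forall q, ambiguity_set d p0 q -> expected_cost J q x <= expected_cost J p x].
Proof.
move=> d0 pp0 p00.
have Wp0 : ambiguity_set d p0 p0.
  by split=> // i; rewrite divff ?gt_eqF// lerDl ltW.
pose W := [set v : 'rV[R]_m | ambiguity_set d p0 (v ord0)].
have rowE (p : 'I_m -> R) : (\row_i p i) ord0 = p.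
  by apply/funext => i; rewrite mxE.
have coordc i : continuous (fun v : 'rV[R]_m => v ord0 i).
  exact: coord_continuous.
have sumc (c : 'I_m -> R) : continuous (fun v : 'rV[R]_m => \sum_i v ord0 i * c i).
  apply: continuous_big => [|i _ v]; first exact: add_continuous.
  by apply: (@continuousM _ _ (fun v : 'rV[R]_m => v ord0 i) (cst (c i)));
    [exact: coordc|exact: cst_continuous].
have closedW : closed W.
  rewrite (_ : W =
     (\bigcap_(i in [set: 'I_m]) (fun v : 'rV[R]_m => v ord0 i) @^-1` [set y | 0 <= y]) `&`
     ((fun v : 'rV[R]_m => \sum_i v ord0 i * 1) @^-1` [set 1]) `&`
     (\bigcap_(i in [set: 'I_m]) (fun v : 'rV[R]_m => v ord0 i) @^-1`
        [set y | y <= (1 + d) * p0 i])).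
    apply: closedI; first apply: closedI.
    - apply: closed_bigI => i _; apply: preimage_closed; last exact: closed_ge.
      by move=> v _; exact: coordc.
    - by apply: preimage_closed => [v _|]; [exact: sumc|exact: closed_eq].
    - apply: closed_bigI => i _; apply: preimage_closed; last exact: closed_le.
      by move=> v _; exact: coordc.
  apply/seteqP; split => v /=.
    move=> [[vge vsum] vd]; split; first split.
    - by move=> i _; exact: vge.
    - by rewrite -[RHS]vsum; apply: eq_bigr => i _; rewrite mulr1.
    - by move=> i _ /=; rewrite -ler_pdivrMr// vd.
  move=> [[vge vsum] vd]; split; first split.
  - by move=> i; exact: vge.
  - by rewrite -[RHS]vsum; apply: eq_bigr => i _; rewrite mulr1.
  - by move=> i; rewrite ler_pdivrMr//; exact: vd.
have compactW : compact W.
  apply: subclosed_compact closedW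
    (@rV_compact _ _ (fun i => `[0, (1 + d) * p0 i]%classic) _) _.
    by move=> i; exact: segment_compact.
  move=> v [[vge _] vd] i /=.
  by rewrite in_itv/= vge -ler_pdivrMr// vd.
have [||v Wv vmax] :=
    compact_EVT_max (f := fun v : 'rV[R]_m => expected_cost J (v ord0) x) _ compactW.
- by exists (\row_i p0 i); rewrite /W/= rowE.
- by apply: continuous_subspaceT; exact: sumc.
rewrite inE in Wv; pose p := v ord0.
have pmax q : ambiguity_set d p0 q -> expected_cost J q x <= expected_cost J p x.
  by move=> Wq; have := vmax (\row_i q i); rewrite rowE; apply; rewrite inE /W/= rowE.
exists p; split => //; apply/eqP; rewrite eq_le; apply/andP; split.
  apply: sup_upper_bound; last by exists p.
  by split; [exists (expected_cost J p0 x); exists p0|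
    exists (expected_cost J p x) => _ [q Wq <-]; exact: pmax].
apply: ge_sup; first by exists (expected_cost J p0 x); exists p0.
by move=> _ [q Wq <-]; exact: pmax.
Qed.

(* Main.v *)
(** For fixed [x], minimizing [htilde] over [lambda >= 0] gives
    [s + (1 + d) max (0, J x i - s)]: the lower bound is [expR u >= 1 + u], with
    equality at [lambda = J x i - s], or at [lambda = 0] when [J x i <= s].
    Hence (B) minimizes [s + (1 + d) \sum_i p0 i max (0, J x i - s)] over [s],
    the dual of the linear program defining the worst-case cost; a quantile of
    [J x] closes the gap, so (A) and (B) have the same value at every [x]. The
    worst-case cost is continuous, and strictly convex because the maximum is
    attained. The dual objective is convex because the perspective of [expR] is
    a supremum of linear functions that are nondecreasing in the cost. *)

Require Import Defs.
From HB Require Import structures.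
From mathcomp Require Import all_boot all_order all_algebra.
From mathcomp Require Import all_classical all_reals all_analysis.
From mathcomp Require Import ring lra.

Set Implicit Arguments.
Unset Strict Implicit.
Unset Printing Implicit Defensive.

Import Order.TTheory GRing.Theory Num.Theory.
Import numFieldNormedType.Exports.

Local Open Scope classical_set_scope.
Local Open Scope ring_scope.

(** * Calculus of functions of class C^k on open sets *)

(** The first-order expansion at [a] only sees values near [a], so [g] inherits it with ['d f a],
    which is then its differential by uniqueness. *)
Lemma near_eq_differentiable (R : numFieldType) (V W : normedModType R)
    (f g : V -> W) (a : V) :
  {near a, f =1 g} -> differentiable f a -> differentiable g a.
Proof.
move=> fg df.
have dfc : continuous ('d f a) by exact: diff_continuous.
have gE : g \o shift a = cst (g a) + 'd f a +o_ (0 : V) id.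
  apply/eqaddoP => _/posnumP[e].
  have := diff_locally df; move/eqaddoP => /(_ e%:num (gt0 _)).
  rewrite -(nbhs_singleton fg).
  have fg0 : \forall h \near (0 : V), f (h + a) = g (h + a).
    have := fg; rewrite [X in X -> _](near_shift 0 a) subr0.
    by apply.
  apply: filterS2 fg0 => h fgh.
  by rewrite !fctE /= fgh.
by apply/diff_locallyP; rewrite (diff_unique dfc gE).
Qed.

Section Ck_theory.
Context {R : realType}.
Implicit Types (V W : normedModType R) (k : nat).

(** Since [U] is open, equality on [U] is equality near each of its points and passes to directional
    derivatives. This lets derivative formulas valid only on [U] be used in the inductions on [k]
    below. *)
Lemma eq_Ck V k (U : set V) (f g : V -> R) :
  open U -> (forall x, U x -> f x = g x) -> Ck k U f -> Ck k U g.
Proof.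
move=> oU; have nearU x P : U x -> (forall y, U y -> P y) -> \near x, P x.
  by move=> Ux UP; apply: filterS UP _; exact: open_nbhs_nbhs.
elim: k f g => [|k IH] f g fg /=.
  move=> cf x Ux; rewrite /prop_for /continuous_at -(fg _ Ux).
  apply: cvg_trans (cf _ Ux); apply: near_eq_cvg; exact: nearU.
move=> [df Df]; split=> [x Ux|v].
  by apply: near_eq_differentiable (df _ Ux); exact: nearU.
apply: IH (Df v) => x Ux; apply: near_eq_derive; exact: nearU.
Qed.

Lemma CkSW V k (U : set V) (f : V -> R) : Ck k.+1 U f -> Ck k U f.
Proof.
elim: k f => [|k IH] f [df Df].
  by move=> x /df; exact: differentiable_continuous.
by split=> // v; apply: IH; exact: Df.
Qed.

Lemma Ck_cst V k (U : set V) (c : R) : Ck k U (fun=> c).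
Proof.
elim: k c => [|k IH] c /=; first by move=> x _; exact: cst_continuous.
split=> [x _|v]; first exact: differentiable_cst.
rewrite (_ : 'D_v _ = fun=> 0)//.
by apply/funext => x; rewrite derive_cst.
Qed.

Lemma Ck_add V k (U : set V) (f g : V -> R) : open U ->
  Ck k U f -> Ck k U g -> Ck k U (fun x => f x + g x).
Proof.
move=> oU; elim: k f g => [|k IH] f g.
  by move=> cf cg x Ux; apply: continuousD; [exact: cf|exact: cg].
move=> [df Df] [dg Dg]; split=> [x Ux|v].
  by apply: differentiableD; [exact: df|exact: dg].
apply: (eq_Ck oU _ (IH _ _ (Df v) (Dg v))) => x Ux; apply/esym.
by apply: deriveD; apply: diff_derivable; [exact: df|exact: dg].
Qed.

Lemma Ck_mul V k (U : set V) (f g : V -> R) : open U ->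
  Ck k U f -> Ck k U g -> Ck k U (fun x => f x * g x).
Proof.
move=> oU; elim: k f g => [|k IH] f g.
  by move=> cf cg x Ux; apply: continuousM; [exact: cf|exact: cg].
move=> Cf Cg; have [[df Df] [dg Dg]] := (Cf, Cg); split=> [x Ux|v].
  by apply: differentiableM; [exact: df|exact: dg].
(* Leibniz rule: the undifferentiated factors are needed only at order [k]. *)
apply: (eq_Ck oU _ (Ck_add oU (IH _ _ (CkSW Cf) (Dg v))
                              (IH _ _ (CkSW Cg) (Df v)))) => x Ux.
by apply/esym/deriveM; apply: diff_derivable; [exact: df|exact: dg].
Qed.

Lemma Ck_sum V k (U : set V) (I : finType) (f : I -> V -> R) : open U ->
  (forall i, Ck k U (f i)) -> Ck k U (fun x => \sum_i f i x).
Proof.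
move=> oU Cf; elim: (index_enum I) => [|i s IH].
  by under eq_fun do rewrite big_nil; exact: Ck_cst.
by under eq_fun do rewrite big_cons; exact: Ck_add.
Qed.

Lemma Ck_expR V k (U : set V) (f : V -> R) : open U ->
  Ck k U f -> Ck k U (fun x => expR (f x)).
Proof.
move=> oU; elim: k f => [|k IH] f.
  by move=> cf x Ux; apply: continuous_comp; [exact: cf|exact: continuous_expR].
have dexp y : differentiable (@expR R) y.
  by apply/derivable1_diffP; exact: derivable_expR.
move=> Cf; have [df Df] := Cf; split=> [x Ux|v].
  by apply: differentiable_comp => //; exact: df.
apply: (eq_Ck oU _ (Ck_mul oU (Df v) (IH _ (CkSW Cf)))) => x Ux; apply/esym.
have dfx := df _ Ux; rewrite (deriveE _ (differentiable_comp dfx (dexp _))).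
rewrite diff_comp//= -(deriveE v dfx) -['D_v f x]mulr1 [LHS]linearZ mulr1.
rewrite -deriveE//.
exact: (congr1 (fun g => 'D_v f x * g (f x)) (derive_expR R)).
Qed.

Lemma Ck_inv V k (U : set V) (f : V -> R) : open U ->
  (forall x, U x -> f x != 0) -> Ck k U f -> Ck k U (fun x => (f x)^-1).
Proof.
move=> oU f_neq0; elim: k => [|k IH].
  by move=> cf x Ux; apply: continuousV; [exact: f_neq0|exact: cf].
move=> Cf; have [df Df] := Cf; split=> [x Ux|v].
  by apply: differentiableV; [exact: df|exact: f_neq0].
have Cfk := IH (CkSW Cf).
have CN1 : Ck k U (fun=> -1) by exact: Ck_cst.
(* The derivative is [- f^-1 * f^-1 * 'D_v f], where [f^-1] is of class C^k by induction. *)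
apply: (eq_Ck oU _ (Ck_mul oU (Ck_mul oU CN1 (Ck_mul oU Cfk Cfk)) (Df v))).
move=> x Ux; rewrite deriveV ?f_neq0//; last exact/diff_derivable/df.
by rewrite mulN1r -invfM.
Qed.

Lemma Ck_linear V k (U : set V) (L : {linear V -> R}) :
  continuous L -> Ck k U L.
Proof.
move=> cL; case: k => [|k] /=; first by move=> x _; exact: cL.
split=> [x _|v]; first exact: linear_differentiable.
rewrite (_ : 'D_v L = fun=> L v); first exact: Ck_cst.
apply/funext => x; rewrite deriveE; last exact: linear_differentiable.
by rewrite diff_lin.
Qed.

(** The derivative of [f \o L] along [v] is ['D_(L v) f \o L], again a composite with [L], so the
    induction closes. *)
Lemma Ck_comp_linear V W k (U : set V) (U' : set W) (L : {linear V -> W})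
    (f : W -> R) :
  open U -> continuous L -> L @` U `<=` U' -> Ck k U' f -> Ck k U (f \o L).
Proof.
move=> oU cL LU.
have {}LU x : U x -> U' (L x) by move=> Ux; apply: LU; exists x.
elim: k f => [|k IH] f.
  by move=> cf x Ux; apply: continuous_comp; [exact: cL|exact/cf/LU].
move=> [df Df]; have dL x := linear_differentiable x cL.
split=> [x Ux|v]; first by apply: differentiable_comp => //; exact/df/LU.
apply: (eq_Ck oU _ (IH _ (Df (L v)))) => x Ux; apply/esym.
have dfx := df _ (LU _ Ux).
rewrite (deriveE _ (differentiable_comp (dL x) dfx)) diff_comp//= diff_lin//.
by rewrite -deriveE.
Qed.

End Ck_theory.

(** * The perspective of the exponential *)

Section perspective.
Context {R : realType}.
Implicit Types l t T c : R.

(** The tangent of [expR] at [c], evaluated at [(T - l) / l] and scaled by [l]: a minorant linear in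
    [(T, l)] and increasing in [T]. *)
Lemma perspective_expR_ge l T c : 0 < l ->
  expR c * (T - c * l) <= l * expR ((T - l) / l).
Proof.
move=> l0; have -> : (T - l) / l = c + ((T - l) / l - c) by ring.
rewrite expRD mulrCA ler_pM2l ?expR_gt0//.
have -> : T - c * l = l * (1 + ((T - l) / l - c)).
  by field; rewrite gt_eqF.
by rewrite ler_pM2l// expR_ge1Dx.
Qed.

Lemma perspective_expR_convex t l1 l2 l T1 T2 T : 0 <= t <= 1 ->
  0 < l1 -> 0 < l2 -> l = t * l1 + (1 - t) * l2 ->
  T <= t * T1 + (1 - t) * T2 ->
  l * expR ((T - l) / l) <=
    t * (l1 * expR ((T1 - l1) / l1)) + (1 - t) * (l2 * expR ((T2 - l2) / l2)).
Proof.
move=> /andP[t0 t1] l10 l20 lE Tle.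
have l0 : 0 < l by rewrite lE; nra.
(* For this [c] the linear minorant is exact at [(T, l)]; it remains to compare it with both
   endpoints. Its positive slope in [T] absorbs the inequality on [T]. *)
set c := (T - l) / l.
have lexpE : l * expR c = expR c * (T - c * l).
  by rewrite /c [in RHS]divfK ?gt_eqF//; ring.
rewrite lexpE; apply: (@le_trans _ _
  (t * (expR c * (T1 - c * l1)) + (1 - t) * (expR c * (T2 - c * l2)))).
  have -> : t * (expR c * (T1 - c * l1)) + (1 - t) * (expR c * (T2 - c * l2)) =
    expR c * (t * T1 + (1 - t) * T2 - c * l) by rewrite lE; ring.
  by rewrite ler_pM2l ?expR_gt0// lerD2r.
by apply: lerD; apply: ler_wpM2l; rewrite ?subr_ge0// perspective_expR_ge.
Qed.

End perspective.

(** * Equality of the two costs at a fixed [x] *)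

Section duality.
Context {R : realType} {n m : nat}.
Variables (J : 'rV[R]_n -> 'I_m -> R) (d : R) (p0 : 'I_m -> R).
Hypotheses (d_gt0 : 0 < d) (p0_pmf : is_pmf p0) (p0_gt0 : forall i, 0 < p0 i).

Let d1_gt0 : 0 < 1 + d. Proof. by rewrite addr_gt0. Qed.

Lemma htilde_ge x i l s : 0 <= l ->
  (s%:E + ((1 + d) * Num.max 0 (J x i - s))%:E <= htilde J d x i l s)%E.
Proof.
rewrite le_eqVlt /htilde eq_sym => /predU1P[->|l0].
  rewrite eqxx; case: ifPn => [Js|_]; last by rewrite leey.
  by rewrite max_l ?subr_le0// mulr0 adde0.
rewrite gt_eqF// -EFinD lee_fin addrC lerD2r -mulrA ler_pM2l//.
rewrite ge_max mulr_ge0 ?(ltW l0) ?expR_ge0//= -addrAC.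
(* The tangent at [0] gives the bound by [J x i - s]; the bound by [0] is positivity of [expR]. *)
have := perspective_expR_ge (J x i - s) 0 l0.
by rewrite expR0 mul1r mul0r subr0.
Qed.

Lemma htilde_min x i s : exists2 l, 0 <= l &
  (htilde J d x i l s = s%:E + ((1 + d) * Num.max 0 (J x i - s))%:E)%E.
Proof.
have [Js|sJ] := leP (J x i) s.
  by exists 0; rewrite // /htilde eqxx Js max_l ?subr_le0// mulr0 adde0.
have Js0 : 0 < J x i - s by rewrite subr_gt0.
exists (J x i - s); first exact: ltW.
rewrite /htilde gt_eqF// -EFinD max_r ?ltW// addrC.
by rewrite (_ : _ - _ - _ = 0) ?mul0r ?expR0 ?mulr1 1?addrC//; ring.
Qed.

Lemma sum_p0_htilde_bound (a : 'I_m -> R) s :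
  (\sum_i (p0 i)%:E * (s%:E + ((1 + d) * Num.max 0 (a i - s))%:E) =
   (s + (1 + d) * \sum_i p0 i * Num.max 0 (a i - s))%:E)%E.
Proof.
rewrite (eq_bigr (fun i =>
  (p0 i * s + (1 + d) * (p0 i * Num.max 0 (a i - s)))%:E)).
  rewrite sumEFin big_split/= -mulr_suml -mulr_sumr.
  by case: p0_pmf => _ ->; rewrite mul1r.
by move=> i _; rewrite -EFinD -EFinM; congr EFin; ring.
Qed.

(* The threshold is the largest value [s] of [a] that is reached or exceeded
   with [p0]-probability at least [1 / (1 + d)]. *)
Lemma ambiguity_set_quantile (a : 'I_m -> R) : (0 < m)%N ->
  exists s, exists2 q, ambiguity_set d p0 q &
    \sum_i q i * a i = s + (1 + d) * \sum_i p0 i * Num.max 0 (a i - s).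
Proof.
move=> m_gt0; have [p0_ge0 p0_sum] := p0_pmf.
pose P j := 1 <= (1 + d) * \sum_(i | a j <= a i) p0 i.
have [j0 Pj0] : exists j, P j.
  (* The smallest value of [a] is reached or exceeded with probability 1. *)
  have [j _ jmin] := @arg_minP _ _ _ (Ordinal m_gt0) predT a isT.
  exists j; rewrite /P (eq_bigl predT) ?p0_sum ?mulr1 ?lerDl ?ltW//.
  by move=> i; rewrite jmin.
have [j Pj jmax] := @arg_maxP _ _ _ j0 P a Pj0.
pose s := a j.
pose A := \sum_(i | s < a i) p0 i; pose B := \sum_(i | a i == s) p0 i.
have B_gt0 : 0 < B.
  rewrite /B (bigD1 j)//= ltr_wpDr//.
  by apply: sumr_ge0 => i _.
have A_le : (1 + d) * A <= 1.
  (* Otherwise some value of [a] exceeds [s], and the least such value [a k] has upper tail [A], so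
     [P k] holds, against the maximality of [s]. *)
  rewrite leNgt; apply/negP => A_gt.
  have [k0 sk0] : exists k, s < a k.
    apply/existsP; rewrite -[X in is_true X]negbK; apply/negP => /existsPn H.
    by move: A_gt; rewrite /A big_pred0 ?mulr0 ?ltr10// => i; exact/negbTE.
  have [k sk kmin] := @arg_minP _ _ _ k0 (fun k => s < a k) a sk0.
  have /jmax : P k.
    rewrite /P (eq_bigl (fun i => s < a i)) ?ltW// => i.
    by apply/idP/idP => [|/kmin//]; exact: lt_le_trans.
  by rewrite /= leNgt sk.
have AB : A + B = \sum_(i | s <= a i) p0 i.
  rewrite [RHS](bigID (fun i => s < a i))/=; congr (_ + _); apply: eq_bigl => i.
    by rewrite andb_idl// => /ltW.
  by rewrite -leNgt eq_le andbC.
have AB_ge : 1 <= (1 + d) * (A + B) by rewrite AB.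
(* The greedy distribution: the maximal ratio [1 + d] above [s], nothing below, and at [s] the ratio
   [th] that brings the total mass to 1. [A_le] and [AB_ge] put [th] between [0] and [1 + d]. *)
pose th := (1 - (1 + d) * A) / B.
have th_ge0 : 0 <= th by rewrite divr_ge0 ?subr_ge0// ltW.
have th_le : th <= 1 + d.
  by rewrite ler_pdivrMr// lerBlDl -mulrDr.
pose q i := if s < a i then (1 + d) * p0 i else
            if a i == s then th * p0 i else 0.
have q_sum : \sum_i q i = 1.
  rewrite (bigID (fun i => s < a i))/=.
  rewrite (eq_bigr (fun i => (1 + d) * p0 i)); last first.
    by move=> i; rewrite /q => ->.
  rewrite -mulr_sumr -/A (bigID (fun i => a i == s))/=.
  rewrite [X in _ + (_ + X)]big1 ?addr0; last first.
    by move=> i /andP[/negbTE h1 /negbTE h2]; rewrite /q h1 h2.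
  rewrite (eq_bigl (fun i => a i == s)); last first.
    by move=> i; rewrite andb_idl// => /eqP ->; rewrite ltxx.
  rewrite (eq_bigr (fun i => th * p0 i)); last first.
    by move=> i /eqP ais; rewrite /q ais ltxx eqxx.
  by rewrite -mulr_sumr -/B divfK ?gt_eqF// addrC subrK.
exists s, q.
  split; first split=> // i.
    rewrite /q; case: ifP => _; first by rewrite mulr_ge0// ltW.
    by case: ifP => _; rewrite // mulr_ge0.
  move=> i; rewrite ler_pdivrMr// /q; case: ifP => // _; case: ifP => _.
    by rewrite ler_pM2r.
  by rewrite mulr_ge0// ltW.
(* Spreading [s] over [q] reduces the identity to one per index: [q i * (a i - s)] equals
   [(1 + d) * p0 i * max (0, a i - s)]. *)
have sE : s = \sum_i q i * s by rewrite -mulr_suml q_sum mul1r.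
rewrite mulr_sumr [X in _ = X + _]sE -big_split/=.
apply: eq_bigr => i _; rewrite /q; have [ais|ais|->] := ltgtP.
- by rewrite max_r ?subr_ge0 ?ltW//; ring.
- by rewrite max_l ?subr_le0 ?ltW//; ring.
- by rewrite subrr maxxx; ring.
Qed.

(** Weak duality: after writing [s] as its mean under [p], bound [J x i - s] by its positive part,
    then [p i] by [(1 + d) * p0 i]. *)
Lemma expected_cost_le p x s : ambiguity_set d p0 p ->
  expected_cost J p x <= s + (1 + d) * \sum_i p0 i * Num.max 0 (J x i - s).
Proof.
move=> [[p_ge0 p_sum] p_le].
have sE : s = \sum_i p i * s by rewrite -mulr_suml p_sum mul1r.
rewrite mulr_sumr [X in _ <= X + _]sE -big_split/=.
apply: ler_sum => i _; rewrite -lerBlDl -mulrBr mulrA.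
apply: (@le_trans _ _ (p i * Num.max 0 (J x i - s))).
  by rewrite ler_wpM2l// le_max lexx orbT.
by rewrite ler_wpM2r ?le_max ?lexx// -ler_pdivrMr.
Qed.

Lemma dual_costE x : (0 < m)%N ->
  dual_cost J d p0 x = (worst_case_cost J d p0 x)%:E.
Proof.
move=> m_gt0; apply/eqP; rewrite eq_le; apply/andP; split.
  (* The quantile [s] with the minimizing multipliers is a dual point whose value is the expected
     cost under a feasible [q]. *)
  have [s [q Wq qE]] := ambiguity_set_quantile (J x) m_gt0.
  have [p [_ <- pmax]] := worst_case_cost_max J x d_gt0 p0_pmf p0_gt0.
  have /choice[l lP] i : exists l, 0 <= l /\
      (htilde J d x i l s = s%:E + ((1 + d) * Num.max 0 (J x i - s))%:E)%E.
    by have [l l0 lE] := htilde_min x i s; exists l.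
  apply: (@le_trans _ _ (expected_cost J q x)%:E); last by rewrite lee_fin pmax.
  apply: ereal_inf_lbound; exists (\row_i l i, s) => /=.
    by move=> i; rewrite mxE; case: (lP i).
  rewrite /dual_objective/= /expected_cost qE -sum_p0_htilde_bound.
  by apply: eq_bigr => i _; rewrite mxE; case: (lP i) => _ ->.
apply: le_ereal_inf_tmp => _ [[l s] /= l_ge0 <-].
have [p [Wp <- _]] := worst_case_cost_max J x d_gt0 p0_pmf p0_gt0.
apply: (@le_trans _ _
  (s + (1 + d) * \sum_i p0 i * Num.max 0 (J x i - s))%:E).
  by rewrite lee_fin expected_cost_le.
rewrite -sum_p0_htilde_bound; apply: lee_sum => i _.
by rewrite lee_pmul2l ?lte_fin ?p0_gt0//; exact: htilde_ge.
Qed.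

End duality.

(** * Continuity and strict convexity of the worst-case cost *)

Section worst_case.
Context {R : realType} {n m : nat}.
Variables (J : 'rV[R]_n -> 'I_m -> R) (d : R) (p0 : 'I_m -> R).
Hypotheses (d_gt0 : 0 < d) (p0_pmf : is_pmf p0) (p0_gt0 : forall i, 0 < p0 i).

Lemma expected_cost_le_worst p x : ambiguity_set d p0 p ->
  expected_cost J p x <= worst_case_cost J d p0 x.
Proof.
have [q [_ <- qmax]] := worst_case_cost_max J x d_gt0 p0_pmf p0_gt0.
exact: qmax.
Qed.

(** A maximizer at one point is feasible at the other, and its weights are at most 1. *)
Lemma worst_case_cost_dist x y :
  `|worst_case_cost J d p0 x - worst_case_cost J d p0 y| <=
    \sum_i `|J x i - J y i|.
Proof.
have le_add u v : worst_case_cost J d p0 u <=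
    worst_case_cost J d p0 v + \sum_i `|J u i - J v i|.
  have [p [Wp <- _]] := worst_case_cost_max J u d_gt0 p0_pmf p0_gt0.
  have [[p_ge0 p_sum] _] := Wp.
  have p_le1 i : p i <= 1.
    by rewrite -p_sum (bigD1 i)//= lerDl sumr_ge0.
  rewrite -lerBlDl; apply: (@le_trans _ _
    (expected_cost J p u - expected_cost J p v)).
    by rewrite lerB// expected_cost_le_worst.
  rewrite /expected_cost -sumrB; apply: ler_sum => i _; rewrite -mulrBr.
  apply: (le_trans (ler_norm _)); rewrite normrM (ger0_norm (p_ge0 i)).
  by rewrite -[leRHS]mul1r ler_wpM2r.
rewrite ler_norml lerBlDl le_add andbT lerBrDr addrC lerBlDr.
by under eq_bigr do rewrite distrC; exact: le_add.
Qed.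

Lemma worst_case_cost_continuous X :
  (forall i, {within X, continuous (J ^~ i)}) ->
  {within X, continuous (worst_case_cost J d p0)}.
Proof.
move=> cJ; apply/subspace_continuousP => x Xx; apply/cvgrPdist_le => e e0.
have sum0 : \sum_i `|J x i - J y i| @[y --> within X (nbhs x)] --> (0 : R).
  have sum_xx : \sum_i `|J x i - J x i| = 0 :> R.
    by rewrite big1// => i _; rewrite subrr normr0.
  rewrite -[X in _ --> X]sum_xx; apply: cvg_big => [|i _].
    exact: add_continuous.
  apply: cvg_norm; apply: cvgB; first exact: cvg_cst.
  by have /subspace_continuousP := cJ i; exact.
have /cvgrPdist_le /(_ e e0) := sum0.
apply: filterS => y; rewrite sub0r normrN; apply: le_trans.
by apply: (le_trans (worst_case_cost_dist _ _)); exact: ler_norm.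
Qed.

(** A supremum of strictly convex functions can lose strictness; here one [p] attains it at the
    intermediate point, and [p] is feasible at both endpoints. *)
Lemma worst_case_cost_strictly_convex X :
  (forall i, strictly_convex_function X (J ^~ i)) ->
  strictly_convex_function X (worst_case_cost J d p0).
Proof.
move=> scJ t x y t01 Xx Xy xy; have /andP[t0 t1] := t01.
have [p [Wp <- _]] :=
  worst_case_cost_max J (t *: x + (1 - t) *: y) d_gt0 p0_pmf p0_gt0.
have [[p_ge0 p_sum] _] := Wp.
apply: (@lt_le_trans _ _
  (t * expected_cost J p x + (1 - t) * expected_cost J p y)); last first.
  by apply: lerD; apply: ler_wpM2l;
    rewrite ?subr_ge0 ?(ltW t0) ?(ltW t1) ?expected_cost_le_worst.
have term_le i : p i * J (t *: x + (1 - t) *: y) i <=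
    p i * (t * J x i + (1 - t) * J y i).
  by rewrite ler_wpM2l// ltW//; exact: scJ.
have -> : t * expected_cost J p x + (1 - t) * expected_cost J p y =
    \sum_i p i * (t * J x i + (1 - t) * J y i).
  rewrite /expected_cost !mulr_sumr -big_split/=; apply: eq_bigr => i _; ring.
(* Some weights may vanish; one positive weight suffices for a strict inequality. *)
have [k pk] : exists k, 0 < p k.
  apply: contrapT => /forallNP p_le0.
  move: p_sum; rewrite big1 => [/esym/eqP|i _].
    by rewrite oner_eq0.
  by apply/eqP; rewrite eq_le p_ge0 andbT leNgt; apply/negP/p_le0.
rewrite /expected_cost (bigD1 k)//= [ltRHS](bigD1 k)//=.
apply: ltr_leD; last by apply: ler_sum => i _; exact: term_le.
by rewrite ltr_pM2l//; exact: scJ.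
Qed.

End worst_case.

(** * Convexity and smoothness of the dual objective *)

Section dual_objective_regularity.
Context {R : realType} {n m : nat}.
Variables (X : set 'rV[R]_n) (J : 'rV[R]_n -> 'I_m -> R).
Variables (d : R) (p0 : 'I_m -> R).
Hypotheses (d_gt0 : 0 < d) (p0_gt0 : forall i, 0 < p0 i).

Let U := [set z : 'rV[R]_n * 'rV[R]_m * R |
          X z.1.1 /\ forall i, 0 < z.1.2 ord0 i].

(** The exponent is regrouped as [(T - l) / l] with [T = J x i - s], to expose the perspective of
    [expR]. *)
Lemma dual_objectiveE z : U z -> dual_objective J d p0 z =
  (\sum_i p0 i * ((1 + d) * (z.1.2 ord0 i *
     expR ((J z.1.1 i - z.2 - z.1.2 ord0 i) / z.1.2 ord0 i)) + z.2))%:E.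
Proof.
move=> [_ l_gt0]; rewrite /dual_objective -sumEFin; apply: eq_bigr => i _.
by rewrite /htilde gt_eqF// -mulrA addrAC.
Qed.

Lemma dual_objective_convex : (forall i, convex_function X (J ^~ i)) ->
  convex_set X -> convex_function U (fun z => fine (dual_objective J d p0 z)).
Proof.
move=> cvxJ cvxX t z1 z2; rewrite !inE => Uz1 Uz2.
have [[Xz1 l1_gt0] [Xz2 l2_gt0]] := (Uz1, Uz2).
have t01 : 0 <= t%:num <= 1 by rewrite ge0 le1.
pose z := t%:num *: z1 + (1 - t%:num) *: z2.
have lE i : z.1.2 ord0 i =
    t%:num * z1.1.2 ord0 i + (1 - t%:num) * z2.1.2 ord0 i.
  by rewrite !mxE.
have sE : z.2 = t%:num * z1.2 + (1 - t%:num) * z2.2 by [].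
have Uz : U z.
  split=> [|i]; last first.
    rewrite lE; have := l1_gt0 i; have := l2_gt0 i; case/andP: t01; nra.
  by have := cvxX z1.1.1 z2.1.1 t; rewrite !inE; exact.
change (fine (dual_objective J d p0 z) <=
  t%:num * fine (dual_objective J d p0 z1) +
  (1 - t%:num) * fine (dual_objective J d p0 z2)).
rewrite !dual_objectiveE//= !mulr_sumr -big_split/=; apply: ler_sum => i _.
set e1 := z1.1.2 ord0 i * expR _; set e2 := z2.1.2 ord0 i * expR _.
set e := z.1.2 ord0 i * expR _.
have e_le : e <= t%:num * e1 + (1 - t%:num) * e2.
  apply: perspective_expR_convex => //.
  (* [J x i - s] is jointly convex in [(x, s)], which is the inequality on [T] that the perspective
     needs. *)
  have : J z.1.1 i <= t%:num * J z1.1.1 i + (1 - t%:num) * J z2.1.1 i.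
    by have := cvxJ i t z1.1.1 z2.1.1; rewrite !inE; exact.
  rewrite -(lerD2r (- z.2)) => /le_trans; apply.
  by rewrite sE; lra.
have -> : t%:num * (p0 i * ((1 + d) * e1 + z1.2)) +
    (1 - t%:num) * (p0 i * ((1 + d) * e2 + z2.2)) =
  p0 i * ((1 + d) * (t%:num * e1 + (1 - t%:num) * e2) + z.2).
  by rewrite sE; ring.
by rewrite ler_pM2l// lerD2r ler_pM2l// addr_gt0.
Qed.

Let fst_fst_continuous : continuous (fun z : 'rV[R]_n * 'rV[R]_m * R => z.1.1).
Proof. by move=> z; apply: continuous_comp; exact: cvg_fst. Qed.

Let snd_fst_continuous : continuous (fun z : 'rV[R]_n * 'rV[R]_m * R => z.1.2).
Proof.
by move=> z; apply: continuous_comp; [exact: cvg_fst|exact: cvg_snd].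
Qed.

Lemma dual_domain_open : open X -> open U.
Proof.
move=> oX; rewrite openE => z [Xz lz].
have nearX : \near z, X z.1.1.
  by apply: (fst_fst_continuous (x := z)); exact: open_nbhs_nbhs.
have nearl i : \forall w \near z, 0 < (w.1.2 : 'rV[R]_m) ord0 i.
  have cl : {for z, continuous
      (fun w : 'rV[R]_n * 'rV[R]_m * R => w.1.2 ord0 i)}.
    apply: (@continuous_comp _ _ _ (fun w : 'rV[R]_n * 'rV[R]_m * R => w.1.2)
      (fun l : 'rV[R]_m => l ord0 i)); first exact: snd_fst_continuous.
    exact: coord_continuous.
  exact: (cl _ (lt_nbhsr (lz i))).
exact: (filterI nearX (filter_forall _ nearl)).
Qed.

Lemma dual_objective_Ck k : open X -> (forall i, Ck k X (J ^~ i)) ->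
  Ck k U (fun z => fine (dual_objective J d p0 z)).
Proof.
move=> oX CJ; have oU := dual_domain_open oX.
apply: (eq_Ck oU) => [z Uz|]; first by rewrite dual_objectiveE.
have Ccoord i : Ck k setT (fun l : 'rV[R]_m => l ord0 i).
  (* The coordinate is packed as a linear map so that [Ck_linear] applies. *)
  have coord_linear : linear (fun l : 'rV[R]_m => l ord0 i : R^o).
    by move=> a u v; rewrite !mxE.
  pose coordM := GRing.isLinear.Build _ _ _ _ _ coord_linear.
  pose coord : {linear 'rV[R]_m -> R} :=
    HB.pack (fun l : 'rV[R]_m => l ord0 i) coordM.
  by apply: (@Ck_linear _ _ k setT coord); exact: coord_continuous.
have Cl i : Ck k U (fun z => z.1.2 ord0 i).
  exact: (Ck_comp_linear (L := snd \o fst) oU snd_fst_continuous _ (Ccoord i)).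
have CJi i : Ck k U (fun z => J z.1.1 i).
  apply: (Ck_comp_linear (L := fst \o fst) oU fst_fst_continuous _ (CJ i)).
  by move=> _ [z [Xz _] <-].
have Cs : Ck k U (fun z => z.2).
  by apply: (@Ck_linear _ _ k U snd) => z; exact: cvg_snd.
have CN (f : 'rV[R]_n * 'rV[R]_m * R -> R) :
    Ck k U f -> Ck k U (fun z => - f z).
  move=> Cf; under eq_fun do rewrite -mulN1r.
  by apply: Ck_mul => //; exact: Ck_cst.
apply: Ck_sum => // i.
apply: Ck_mul (Ck_cst _ _ _) _ => //; apply: Ck_add (Cs) => //.
apply: Ck_mul (Ck_cst _ _ _) _ => //; apply: Ck_mul => //; apply: Ck_expR => //.
apply: Ck_mul => //; last by apply: Ck_inv => // z [_ lz]; rewrite gt_eqF.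
exact: (Ck_add oU (Ck_add oU (CJi i) (CN _ Cs)) (CN _ (Cl i))).
Qed.

End dual_objective_regularity.

(** * Minimizers, uniqueness and regularity *)

Theorem theorem2 (R : realType) (n m : nat) (n_gt0 : (0 < n)%N)
    (m_gt0 : (0 < m)%N) (X : set 'rV[R]_n) (X_neq0 : X !=set0)
    (J : 'rV[R]_n -> 'I_m -> R) (d : R) (d_gt0 : 0 < d)
    (p0 : 'I_m -> R) (p0_pmf : is_pmf p0) (p0_gt0 : forall i, 0 < p0 i) :
  [/\ forall x, dual_minimizer X J d p0 x <-> worst_case_minimizer X J d p0 x,
      bounded_set X -> closed X -> convex_set X ->
      (forall i, strictly_convex_function X (J ^~ i)) ->
      (forall i, {within X, continuous (J ^~ i)}) ->
      exists! x, dual_minimizer X J d p0 x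
    & forall k : nat,
      open X -> convex_set X ->
      (forall i, convex_function X (J ^~ i)) ->
      (forall i, Ck k X (J ^~ i)) ->
      let U := [set z : 'rV[R]_n * 'rV[R]_m * R |
                 X z.1.1 /\ forall i, 0 < z.1.2 ord0 i] in
      [/\ forall z, U z -> dual_objective J d p0 z \is a fin_num,
          convex_function U (fun z => fine (dual_objective J d p0 z))
        & Ck k U (fun z => fine (dual_objective J d p0 z))]].
Proof.
split=> [x|bX cX cvxX scJ cJ|k oX cvxX cvxJ CJ U].
- rewrite /dual_minimizer /worst_case_minimizer.
  split=> -[Xx xmin]; split=> // y Xy.
    by have := xmin y Xy; rewrite !dual_costE// lee_fin.
  by rewrite !dual_costE// lee_fin; exact: xmin.
- have dualE x y : (dual_cost J d p0 x <= dual_cost J d p0 y)%E =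
      (worst_case_cost J d p0 x <= worst_case_cost J d p0 y).
    by rewrite !dual_costE.
  (* Existence: a continuous function attains its minimum on a nonempty compact set. *)
  have [x Xx xmin] := compact_EVT_min X_neq0 (bounded_closed_compact bX cX)
    (worst_case_cost_continuous d_gt0 p0_pmf p0_gt0 cJ).
  rewrite inE in Xx; exists x; split=> [|y [Xy ymin]].
    by split=> // y Xy; rewrite dualE xmin// inE.
  apply/eqP/negPn/negP => xy.
  (* Uniqueness: at the midpoint of two distinct minimizers the cost would be strictly below the
     minimum. *)
  have half01 : 0 < (2^-1 : R) < 1 by apply/andP; split; lra.
  have [half_ge0 half_le1] : 0 <= (2^-1 : R) /\ (2^-1 : R) <= 1 by split; lra.
  have Xz : X (2^-1 *: x + (1 - 2^-1) *: y).
    by have := cvxX x y (Itv01 half_ge0 half_le1); rewrite !inE; exact.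
  have := worst_case_cost_strictly_convex d_gt0 p0_pmf p0_gt0 scJ half01 Xx Xy xy.
  have := xmin y; rewrite inE => /(_ Xy).
  have := ymin _ Xz; rewrite dualE.
  lra.
- split.
  + by move=> z Uz; rewrite (dual_objectiveE _ _ _ Uz).
  + exact: dual_objective_convex.
  + exact: dual_objective_Ck.
Qed.
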